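(* Let $k$ be a non-negative integer. Then $$X(k)\le (k+4)^3\left(32\log_p(k+1)+96\right)^k,$$ where $X(k):=\max_{m,\ell\in\mathbb N}\dim\operatorname{Ext}^k(\Delta_m,\Delta_\ell)$.
   Context: Let $p$ be a prime and $\mathbb F$ an algebraically closed field of characteristic $p$. $\mathbb N$ is the set of positive integers. For $q\ge 2$ consider a block of polynomial representations of $GL_2(\mathbb F)$ with $p^q$ simple modules (all such blocks are equivalent), and let $\Delta_1,\dots,\Delta_{p^q}$ be its Weyl (= standard) modules, numbered according to the total order on the highest weights in the block. $\operatorname{Ext}^k$ denotes the $k$-th extension group over $\mathbb F$. For positive integers $m,\ell$, $\dim\operatorname{Ext}^k(\Delta_m,\Delta_\ell)$ is computed using any $q\ge2$ with $m,\ell\le p^q$; the value does not depend on $q$. Known description used throughout (Miemietz--Turner): $\operatorname{Ext}^k(\Delta_m,\Delta_\ell)$ has a basis indexed by the finite set $\mathcal B^k(m,\ell)$, so $\dim\operatorname{Ext}^k(\Delta_m,\Delta_\ell)=\sharp\mathcal B^k(m,\ell)$, where $\mathcal B^k(m,\ell)$ is defined as follows. Put $\mathcal P_{\mathfrak c}=\{(s,x,y,t)\in\mathbb Z^4: 1\le s\le t\le p,\ 0\le x+y\le 1,\ t-s=x+2y,\ \text{and } x=y=0\text{ if }s=t\}$; $\mathcal P_0=\{(s,0,0,t)\in\mathbb Z^4: 1\le s,t\le p,\ s+t=p+1\}\setminus\{(p,0,0,1)\}$; $\mathcal P_M=\{(s,x,y,t)\in\mathbb Z^4: 1\le s,t\le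 p,\ x+2y+2=t-1-s+p,\ 0\le x+y+2\le 1\}$; $\mathcal P_{\overline M}=\mathcal P_M\setminus\{(p,0,-1,1)\}$. Let $\mathcal M$ be the set of $(s,x,y,a,b,t)\in\mathbb Z^6$ with $a,b\ge 0$ such that one of the following holds: $a=b$ and $(s,x,y,t)\in\mathcal P_{\mathfrak c}$; or $a=b-1$ and $(s,x,y,t)\in\mathcal P_0$; or $a=b+1$ and $(s,x,y,t)\in\mathcal P_{\overline M}$; or $a>b+1$ and $(s,x,y,t)\in\mathcal P_M$. To such an element associate $i=-a-b$; $j=x-(a-b-1)p+1$ if $a\ge b+1$, $j=x$ if $a=b$, $j=x+1$ if $a=b-1$; and $k=y+(a-b-1)(p-1)$ if $a\ge b+1$, $k=y$ if $a\le b$. Let $\mathcal P_{\Upsilon^{\le 0}}$ be the set of all resulting $(s,i,j,k,a,b,t)\in\mathbb Z^7$, and $\mathcal P_{\Upsilon^{\le 1}}=\mathcal P_{\Upsilon^{\le 0}}\cup\{(s,1,1,0,0,0,p+1-s):1\le s\le p\}$. For $1\le m,\ell\le p^q$ let $s_g,t_g\in\{1,\dots,p\}$ $(1\le g\le q)$ be the unique numbers with $m-1=\sum_{g=1}^q(s_g-1)p^{q-g}$ and $\ell-1=\sum_{g=1}^q(t_g-1)p^{q-g}$. For $k\in\mathbb Z$, $\mathcal B^k(m,\ell)$ is the set of $q$-tuples $(\mathbf v_1,\dots,\mathbf v_q)$ with $\mathbf v_g=(s_g,i_g,j_g,k_g,a_g,b_g,t_g)\in\mathcal P_{\Upsilon^{\le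 1}}$ for all $g$, $i_1=0$, $i_g=j_{g-1}$ for $2\le g\le q$, and $k_1+\dots+k_q=k$. *)

(* Defs.v *)
From HB Require Import structures.
From mathcomp Require Import all_boot all_order all_algebra.
From mathcomp Require mpoly.
From Stdlib Require Import Relation_Operators.

Set Implicit Arguments.
Unset Strict Implicit.
Unset Printing Implicit Defensive.

Import Order.TTheory GRing.Theory Num.Theory.
Local Open Scope ring_scope.

(* Entry (i, j) is the coefficient of x^(n-i) y^i in
   (g00 x + g10 y)^(n-j) (g01 x + g11 y)^j : this is the action of g on
   Sym^n of the natural module of columns, dehomogenised at x = 1. *)
Definition sym_mx (R : comNzRingType) (n : nat) (g : 'M[R]_2) : 'M[R]_n.+1 :=
  \matrix_(i, j) (((g 0 0)%:P + (g 1 0) *: 'X) ^+ (n - j)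
                  * ((g 0 1)%:P + (g 1 1) *: 'X) ^+ j)`_i.

(* The Weyl module of highest weight (n + b, b), as the contravariant dual of
   Sym^n (x) det^b. *)
Definition weyl_mx (R : comNzRingType) (n b : nat) (g : 'M[R]_2) :
    'M[R]_n.+1 :=
  \det g ^+ b *: (sym_mx n g^T)^T.

Lemma sym_mx1 (R : comNzRingType) n : sym_mx n (1%:M : 'M[R]_2) = 1%:M.
Proof.
apply/matrixP => i j; rewrite !mxE /= scale0r scale1r addr0 add0r expr1n mul1r.
by rewrite coefXn.
Qed.

Section Homogenisation.
Variables (R : comNzRingType) (A B : {poly R}).

Let hom m (p : {poly R}) : {poly R} :=
  \sum_(i < m.+1) p`_i *: (A ^+ (m - i) * B ^+ i).

Let homM m (a b : R) (p : {poly R}) : (size p <= m.+1)%N ->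
  hom m.+1 ((a%:P + b *: 'X) * p) = (a *: A + b *: B) * hom m p.
Proof.
move=> sp; rewrite {1}/hom.
under eq_bigr => i _ do
  rewrite mulrDl coefD mul_polyC -scalerAl !coefZ coefXM scalerDl.
rewrite big_split /= mulrDl; congr (_ + _).
  rewrite big_ord_recr /= (nth_default 0 sp) mulr0 scale0r addr0 mulr_sumr.
  apply: eq_bigr => i _; rewrite (subSn (leq_ord i)) exprS -scalerA.
  by rewrite -scalerAl -scalerAr mulrA.
rewrite big_ord_recl /= mulr0 scale0r add0r mulr_sumr.
apply: eq_bigr => i _; rewrite /= /bump /= add1n subSS exprS -scalerA.
by rewrite -scalerAl -scalerAr (mulrCA B).
Qed.

Let size_linM m (a b : R) (p : {poly R}) : (size p <= m.+1)%N ->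
  (size ((a%:P + b *: 'X) * p)%R <= m.+2)%N.
Proof.
move=> sp; rewrite (leq_trans (size_polyMleq _ _)) //.
rewrite -subn1 leq_subLR add1n -[m.+3]/(2 + m.+1)%N leq_add //.
rewrite (leq_trans (size_polyD _ _)) // geq_max.
rewrite (leq_trans (size_polyC_leq1 _)) //=.
by rewrite (leq_trans (size_scale_leq _ _)) // size_polyX.
Qed.

Lemma homogenise_lin (a b c d : R) k l :
  \sum_(i < (k + l).+1) ((a%:P + b *: 'X) ^+ k * (c%:P + d *: 'X) ^+ l)`_i
     *: (A ^+ (k + l - i) * B ^+ i)
  = (a *: A + b *: B) ^+ k * (c *: A + d *: B) ^+ l.
Proof.
suff [] : hom (k + l) ((a%:P + b *: 'X) ^+ k * (c%:P + d *: 'X) ^+ l)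
          = (a *: A + b *: B) ^+ k * (c *: A + d *: B) ^+ l
        /\ (size ((a%:P + b *: 'X) ^+ k * (c%:P + d *: 'X) ^+ l)%R
            <= (k + l).+1)%N by [].
elim: k => [|k [IH1 IH2]]; last first.
  by rewrite !exprS addSn -!mulrA homM // IH1 size_linM.
rewrite !expr0 !mul1r add0n; elim: l => [|l [IH1 IH2]]; last first.
  by rewrite !exprS homM // IH1 size_linM.
by rewrite !expr0 /hom big_ord1 subnn !expr0 mulr1 coef1 scale1r size_poly1.
Qed.

End Homogenisation.

Lemma sym_mxM (R : comNzRingType) n (g h : 'M[R]_2) :
  sym_mx n (g *m h) = sym_mx n g *m sym_mx n h.
Proof.
apply/matrixP => i j; have jn : (j <= n)%N by rewrite -ltnS.
have E (c : 'I_2) : ((g *m h) 0 c)%:P + (g *m h) 1 c *: 'X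
    = h 0 c *: ((g 0 0)%:P + g 1 0 *: 'X) + h 1 c *: ((g 0 1)%:P + g 1 1 *: 'X).
  rewrite !mxE !big_ord_recl !big_ord0 !addr0 /=.
  have -> : lift ord0 ord0 = 1 :> 'I_2 by apply: val_inj.
  rewrite !scalerDr !scalerA polyCD scalerDl -!mul_polyC.
  rewrite ![h _ _ * _]mulrC !polyCM addrACA.
  by rewrite ![(h _ _)%:P * (g _ _)%:P]mulrC.
rewrite [LHS]mxE !E -homogenise_lin subnK // coef_sum mxE.
by apply: eq_bigr => k _; rewrite !mxE coefZ mulrC.
Qed.

Lemma map_sym_mx (R S : comNzRingType) (f : {rmorphism R -> S}) n
    (g : 'M[R]_2) :
  sym_mx n (map_mx f g) = map_mx f (sym_mx n g).
Proof.
apply/matrixP => i j; rewrite !mxE -coef_map rmorphM !rmorphXn /=.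
by rewrite !rmorphD /= !map_polyC !map_polyZ /= map_polyX.
Qed.

Lemma map_weyl_mx (R S : comNzRingType) (f : {rmorphism R -> S}) n b
    (g : 'M[R]_2) :
  weyl_mx n b (map_mx f g) = map_mx f (weyl_mx n b g).
Proof.
by rewrite /weyl_mx map_mxZ rmorphXn /= det_map_mx -map_trmx -map_sym_mx
  -map_trmx.
Qed.

Lemma weyl_mx1 (R : comNzRingType) n b :
  weyl_mx n b (1%:M : 'M[R]_2) = 1%:M.
Proof. by rewrite /weyl_mx det1 expr1n scale1r !(trmx1, sym_mx1). Qed.

Lemma weyl_mxM (R : comNzRingType) n b (g h : 'M[R]_2) :
  weyl_mx n b (g *m h) = weyl_mx n b g *m weyl_mx n b h.
Proof.
rewrite /weyl_mx det_mulmx exprMn trmx_mul sym_mxM trmx_mul.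
by rewrite -scalemxAl -scalemxAr scalerA.
Qed.

Module PolyRep.
Import mpoly.

(* Finite-dimensional left modules, acting on columns; [rep_mx] is relevant on
   invertible matrices only. *)
Record polyrep (F : fieldType) := {
  rep_dim : nat;
  rep_mx : 'M[F]_2 -> 'M[F]_rep_dim;
  rep_mx1 : rep_mx 1%:M = 1%:M;
  rep_mxM : forall g h, g \in unitmx -> h \in unitmx ->
    rep_mx (g *m h) = rep_mx g *m rep_mx h;
  rep_poly : exists P : 'M[{mpoly F[2 * 2]}]_rep_dim,
    forall g, g \in unitmx ->
      rep_mx g = map_mx (meval (fun c => mxvec g 0 c)) P }.

Lemma weyl_mx_poly (F : fieldType) n b :
  exists P : 'M[{mpoly F[2 * 2]}]_n.+1, forall g, g \in unitmx ->
    weyl_mx n b g = map_mx (meval (fun c => mxvec g 0 c)) P.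
Proof.
exists (weyl_mx n b (vec_mx (\row_c 'X_c))) => g _.
rewrite -map_weyl_mx; congr weyl_mx; apply/matrixP => i j.
by rewrite !mxE /= mevalXU mxvecE.
Qed.

Definition weyl (F : fieldType) (n b : nat) : polyrep F :=
  Build_polyrep (weyl_mx1 F n b) (fun g h _ _ => weyl_mxM n b g h)
    (weyl_mx_poly F n b).

End PolyRep.
From mathcomp Require Import all_classical all_reals all_analysis.
Export PolyRep.
Local Open Scope classical_set_scope.
Local Open Scope card_scope.

Section Ext.
Variable F : fieldType.
Implicit Types L M N P : polyrep F.

Definition rep_hom M N (f : 'M[F]_(rep_dim N, rep_dim M)) : Prop :=
  forall g, g \in unitmx -> f *m rep_mx M g = rep_mx N g *m f.

Definition rep_surj M N (f : 'M[F]_(rep_dim N, rep_dim M)) : Prop :=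
  forall v : 'cV[F]_(rep_dim N), exists w : 'cV[F]_(rep_dim M), f *m w = v.

Definition rep_exact L M N (f : 'M[F]_(rep_dim M, rep_dim L))
    (g : 'M[F]_(rep_dim N, rep_dim M)) : Prop :=
  forall v : 'cV[F]_(rep_dim M),
    g *m v = 0 <-> exists w : 'cV[F]_(rep_dim L), f *m w = v.

Definition rep_projective P : Prop :=
  forall M N (f : 'M[F]_(rep_dim N, rep_dim M))
             (h : 'M[F]_(rep_dim N, rep_dim P)),
    rep_hom f -> rep_surj f -> rep_hom h ->
    exists2 h' : 'M[F]_(rep_dim M, rep_dim P), rep_hom h' & f *m h' = h.

Record proj_resolution M := {
  res_obj :> nat -> polyrep F;
  res_d : forall i, 'M[F]_(rep_dim (res_obj i), rep_dim (res_obj i.+1));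
  res_aug : 'M[F]_(rep_dim M, rep_dim (res_obj 0));
  res_projective : forall i, rep_projective (res_obj i);
  res_d_hom : forall i, rep_hom (res_d i);
  res_aug_hom : rep_hom res_aug;
  res_aug_surj : rep_surj res_aug;
  res_exact0 : rep_exact (res_d 0) res_aug;
  res_exact : forall i, rep_exact (res_d i.+1) (res_d i) }.

Definition cocycle M N (Q : proj_resolution M) k
    (f : 'M[F]_(rep_dim N, rep_dim (Q k))) : Prop :=
  rep_hom f /\ f *m res_d Q k = 0.

Definition coboundary M N (Q : proj_resolution M) k :
    'M[F]_(rep_dim N, rep_dim (Q k)) -> Prop :=
  match k with
  | 0 => fun f => f = 0
  | k'.+1 => fun f =>
      exists2 h : 'M[F]_(rep_dim N, rep_dim (Q k')),
        rep_hom h & f = h *m res_d Q k'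
  end.

(* The k-th cohomology of Hom(Q, N) has dimension d, for some projective
   resolution Q of M in the category of polynomial representations. *)
Definition is_ext_dim M N (k d : nat) : Prop :=
  exists (Q : proj_resolution M)
         (Z B : {vspace 'M[F]_(rep_dim N, rep_dim (Q k))}),
    [/\ forall f, f \in Z <-> cocycle f,
        forall f, f \in B <-> coboundary f &
        \dim Z = (\dim B + d)%N].

Definition ext_dim M N (k : nat) : nat := xget 0%N [set d | is_ext_dim M N k d].

Definition rep_simple M : Prop :=
  (0 < rep_dim M)%N /\
  forall U : {vspace 'cV[F]_(rep_dim M)},
    (forall g v, g \in unitmx -> v \in U -> rep_mx M g *m v \in U) ->
    U = 0%VS \/ U = fullv.

(* The pair lambda = (n, b) stands for the highest weight (n + b, b), and the
   simple module of highest weight lambda is the head of the Weyl module. *)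
Definition simple_head (lambda : nat * nat) (L : polyrep F) : Prop :=
  rep_simple L /\
  exists2 f : 'M[F]_(rep_dim L, rep_dim (weyl F lambda.1 lambda.2)),
    rep_hom f & rep_surj f.

Definition ext1_linked (lambda mu : nat * nat) : Prop :=
  exists L M, [/\ simple_head lambda L, simple_head mu M & ext_dim L M 1 != 0%N].

Definition same_block : nat * nat -> nat * nat -> Prop :=
  clos_refl_sym_trans _ ext1_linked.

(* w lists the highest weights of one block in increasing order: the degree
   n + 2b is constant on a block, so (n + b, b) increases with n. *)
Definition is_block (w : seq (nat * nat)) : Prop :=
  [/\ w != [::],
      sorted (fun lambda mu => (lambda.1 < mu.1)%N) w &
      forall lambda mu, lambda \in w -> (mu \in w <-> same_block lambda mu)].

(* Weyl modules of the block are numbered from 1. *)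
Definition block_weyl (w : seq (nat * nat)) (m : nat) : polyrep F :=
  let lambda := nth (0, 0)%N w m.-1 in weyl F lambda.1 lambda.2.

End Ext.

Section Combinatorics.
Variable p : nat.

Definition int4 : Type := (int * int * int * int)%type.
Definition int6 : Type := (int * int * int * int * int * int)%type.
Definition int7 : Type := (int * int * int * int * int * int * int)%type.

Definition P_c : set int4 :=
  [set v : int4 | let '(s, x, y, t) := v in
    [/\ 1 <= s <= t, t <= p%:Z, 0 <= x + y <= 1, t - s = x + 2 * y
      & s = t -> x = 0 /\ y = 0]].

Definition P_0 : set int4 :=
  [set v : int4 | let '(s, x, y, t) := v in
    [/\ x = 0, y = 0, 1 <= s <= p%:Z, 1 <= t <= p%:Z & s + t = p%:Z + 1]]
  `\ (p%:Z, 0, 0, 1).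

Definition P_M : set int4 :=
  [set v : int4 | let '(s, x, y, t) := v in
    [/\ 1 <= s <= p%:Z, 1 <= t <= p%:Z, x + 2 * y + 2 = t - 1 - s + p%:Z
      & 0 <= x + y + 2 <= 1]].

Definition P_Mbar : set int4 := P_M `\ (p%:Z, 0, -1, 1).

Definition M_set : set int6 :=
  [set v : int6 | let '(s, x, y, a, b, t) := v in
    [/\ 0 <= a, 0 <= b &
        [\/ a = b /\ P_c (s, x, y, t),
            a = b - 1 /\ P_0 (s, x, y, t),
            a = b + 1 /\ P_Mbar (s, x, y, t)
          | b + 1 < a /\ P_M (s, x, y, t)]]].

Definition upsilon_of (v : int6) : int7 :=
  let '(s, x, y, a, b, t) := v in
  let i := - a - b in
  let j := if b + 1 <= a then x - (a - b - 1) * p%:Z + 1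
           else if a == b then x else x + 1 in
  let k := if b + 1 <= a then y + (a - b - 1) * (p%:Z - 1) else y in
  (s, i, j, k, a, b, t).

Definition P_upsilon_le0 : set int7 := upsilon_of @` M_set.

Definition P_upsilon_le1 : set int7 :=
  P_upsilon_le0 `|`
  [set v | exists2 s : int, 1 <= s <= p%:Z
                          & v = (s, 1, 1, 0, 0, 0, p%:Z + 1 - s)].

Definition up_s (v : int7) : int := let '(s, i, j, k, a, b, t) := v in s.
Definition up_i (v : int7) : int := let '(s, i, j, k, a, b, t) := v in i.
Definition up_j (v : int7) : int := let '(s, i, j, k, a, b, t) := v in j.
Definition up_k (v : int7) : int := let '(s, i, j, k, a, b, t) := v in k.
Definition up_t (v : int7) : int := let '(s, i, j, k, a, b, t) := v in t.

(* m - 1 = \sum_(1 <= g <= q) (s_g - 1) p^(q-g) with s_g in {1, .., p}; indices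
   are shifted to 0 <= g < q. *)
Definition digits_of (q m : nat) (s : 'I_q -> int) : Prop :=
  (forall g, 1 <= s g <= p%:Z) /\
  m%:Z - 1 = \sum_(g < q) (s g - 1) * p%:Z ^+ (q - g.+1).

(* B^k(m, l) *)
Definition ext_basis (q : nat) (k : int) (m l : nat) : set {ffun 'I_q -> int7} :=
  [set v : {ffun 'I_q -> int7} |
    [/\ forall g, P_upsilon_le1 (v g),
        digits_of m (fun g => up_s (v g)) /\ digits_of l (fun g => up_t (v g)),
        forall g : 'I_q, g = 0%N :> nat -> up_i (v g) = 0,
        forall g h : 'I_q, h = g.+1 :> nat -> up_i (v h) = up_j (v g)
      & \sum_(g < q) up_k (v g) = k]].

End Combinatorics.
Arguments ext_basis : clear implicits.

(* The theorem of Miemietz and Turner: B^k(m, l) is finite, and indexes a basis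
   of Ext^k between the m-th and the l-th Weyl module of any block with p^q
   simple modules. *)
Definition Miemietz_Turner (F : fieldType) (p : nat) : Prop :=
  forall (q : nat) (w : seq (nat * nat)),
    (2 <= q)%N -> is_block F w -> size w = (p ^ q)%N ->
    forall k m l : nat, (0 < m <= p ^ q)%N -> (0 < l <= p ^ q)%N ->
      ext_basis p q k%:Z m l
        #= `I_(ext_dim (block_weyl F w m) (block_weyl F w l) k).

(* The values dim Ext^k(Delta_m, Delta_l) for m, l >= 1, each computed in the
   blocks w q with 2 <= q and m, l <= p^q. *)
Definition weyl_ext_dims (F : fieldType) (p : nat)
    (w : nat -> seq (nat * nat)) (k : nat) : set nat :=
  [set d | exists q m l : nat,
    [/\ (2 <= q)%N, (0 < m <= p ^ q)%N, (0 < l <= p ^ q)%N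
      & d = ext_dim (block_weyl F (w q) m) (block_weyl F (w q) l) k]].

(* Main.v *)
(* Write n = -i for the state of a path (v_1, .., v_q) between two consecutive
   steps, so that a path starts at n = 0, and give the step (s,i,j,k,a,b,t) the
   weight k + j - i; it is equal to 2b + e for some e in {0,1}. Given the digits
   s, t and the state, the weight determines the step. The weights are
   nonnegative and telescope: their sum is k + j_q <= k + 1, where k is now the
   total degree. A step of weight 0 is either the only one allowed by the
   digits, and then does not change the state, or it raises the state: 0 to
   >= 1, 1 to >= 2, and n >= 2 to n' with n' - 1 >= p (n - 1). As states do not
   exceed k, at most 2 + log_p k raising steps occur between two steps of
   positive weight. Putting W for the weight still available and
   a = trunc_log_p k + 4, induction bounds the number of paths by a^W, hence by
   a^(k+1). *)
Require Import Defs.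
From mathcomp Require Import all_boot all_order all_algebra.
From mathcomp Require Import zify lra.
From mathcomp Require Import all_classical all_reals all_analysis.

Import Order.TTheory GRing.Theory Num.Theory.
Local Open Scope ring_scope.
Local Open Scope classical_set_scope.
Local Open Scope card_scope.

Set Implicit Arguments.
Unset Strict Implicit.

(** * Steps of a path and their weights *)

Definition weight (v : int7) : int := up_k v + up_j v - up_i v.

(* [e] is [x + y] in the first two cases and [x + y + 2] in the third one. *)
Lemma upsilonP (p : nat) (s i j k a b t : int) :
  P_upsilon_le1 p (s, i, j, k, a, b, t) ->
  [/\ 1 <= s <= p%:Z, 1 <= t <= p%:Z, 0 <= a & 0 <= b] /\
  exists2 e : int, 0 <= e <= 1 &
  [\/ [/\ a = b, i = - a - b, s <= t, j = 2 * e - (t - s)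
        & k = t - s - e /\ (s = t -> e = 0)],
      [/\ a = b - 1, i = - a - b, j = 1, k = 0
        & [/\ e = 0, s + t = p%:Z + 1 & s < p%:Z]],
      [/\ b + 1 <= a, i = - a - b,
          j = 2 * e - 1 - (t - s + p%:Z - 1) - (a - b - 1) * p%:Z,
          k = t - s + p%:Z - 1 - e + (a - b - 1) * (p%:Z - 1)
        & a = b + 1 -> s = p%:Z -> t = 1 -> e = 0]
    | [/\ a = 0, b = 0, i = 1, j = 1 & [/\ e = 0, k = 0 & s + t = p%:Z + 1]]].
Proof.
case; last first.
  case=> s0 hs [-> -> -> -> -> -> ->]; split; first by split; lia.
  by exists 0 => //; constructor 4; split=> //; split=> //; lia.
case=> -[[[[[s0 x] y] a0] b0] t0] H [es <- <- <- ea eb et].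
move: H; rewrite {}es {}ea {}eb {}et => -[a_ge0 b_ge0 H].
case: H => -[ab].
- case=> hs ht hxy hts hx; split; first by split; lia.
  exists (x + y); first by lia.
  constructor 1; have -> : b + 1 <= a = false by lia.
  by rewrite ab eqxx; split=> //; lia.
- case=> -[x0 y0 hs ht hst] neq; split; first by split; lia.
  exists 0 => //; constructor 2.
  have -> : b + 1 <= a = false by lia.
  have -> : (a == b) = false by lia.
  split=> //; rewrite ?x0 ?y0 //; split=> //.
  rewrite lt_neqAle; case/andP: hs => _ ->; rewrite andbT; apply/eqP => sp.
  by apply: neq; rewrite sp x0 y0; congr (_, _, _, _); lia.
- case=> -[hs ht hxy hxy2] neq; split; first by split; lia.
  exists (x + y + 2) => //; constructor 3.
  have -> : b + 1 <= a by lia.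
  split=> //; try nia.
  (* With [s = p] and [t = 1], the value [e = 1] gives [x = 0] and [y = -1], the tuple removed from
     [P_M]. *)
  move=> _ sp t1; case/andP: hxy2 => h0 h1.
  have [//|e1] : x + y + 2 = 0 \/ x + y + 2 = 1 by lia.
  case: neq; rewrite sp t1; congr (_, _, _, _); lia.
- case=> hs ht hxy hxy2; split; first by split; lia.
  exists (x + y + 2) => //; constructor 3.
  have -> : b + 1 <= a by lia.
  by split=> //; nia.
Qed.

Ltac upsilon_cases H :=
  case: H => [[? ? ? ? [? ?]]|[? ? ? ? [? ? ?]]|[? ? ? ? ?]|[? ? ? ? [? ? ?]]].

Section Step.
Variables (p : nat) (p_gt1 : (1 < p)%N).

(** In the third case with [a = b + 1], only [s = p], [t = 1] could give [-e], and there [e = 0];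
    for [a >= b + 2] the term [(a - b - 1) * (p - 1)] makes up for [-e]. *)
Lemma up_k_ge0 v : P_upsilon_le1 p v -> 0 <= up_k v.
Proof.
case: v => -[[[[[s i] j] k] a] b] t /upsilonP [[hs ht ha hb] [e he H]] /=.
upsilon_cases H; try lia.
have [c1|c1] : a = b + 1 \/ b + 2 <= a by lia.
  by subst a; lia.
nia.
Qed.

Lemma up_j_le1 v : P_upsilon_le1 p v -> up_j v <= 1.
Proof.
case: v => -[[[[[s i] j] k] a] b] t /upsilonP [[hs ht ha hb] [e he H]] /=.
by upsilon_cases H; nia.
Qed.

Lemma weight_ge0 v : P_upsilon_le1 p v -> 0 <= weight v.
Proof.
case: v => -[[[[[s i] j] k] a] b] t /upsilonP [[hs ht ha hb] [e he H]].
by rewrite /weight /=; upsilon_cases H; nia.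
Qed.

Lemma up_j_eq1 v : P_upsilon_le1 p v -> up_i v = 1 -> up_j v = 1.
Proof.
case: v => -[[[[[s i] j] k] a] b] t /upsilonP [[hs ht ha hb] [e he H]] /=.
by upsilon_cases H; lia.
Qed.

Lemma weight_i1 v : P_upsilon_le1 p v -> up_i v = 1 -> weight v = 0.
Proof.
case: v => -[[[[[s i] j] k] a] b] t /upsilonP [[hs ht ha hb] [e he H]].
by rewrite /weight /=; upsilon_cases H; lia.
Qed.

(** For [i <= 0] the weight is [e + 2 * b]: its parity gives [e], hence [b], and [i = - a - b] gives
    [a]; these and the digits fix [j] and [k]. For [i = 1] only the added elements remain. *)
Lemma weight_inj v w : P_upsilon_le1 p v -> P_upsilon_le1 p w ->
  up_s v = up_s w -> up_t v = up_t w -> up_i v = up_i w ->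
  weight v = weight w -> v = w.
Proof.
case: v => -[[[[[s i] j] k] a] b] t /upsilonP [[hs ht ha hb] [e he H]].
case: w => -[[[[[s' i'] j'] k'] a'] b'] t' /upsilonP.
case=> -[_ _ ha' hb'] [e' he' H'] /= ss tt ii; rewrite -{}ss -{}tt -{}ii in H' *.
rewrite /weight /= => ww.
have [hi|hi] : i = 1 \/ i <= 0 by upsilon_cases H; lia.
  by upsilon_cases H; upsilon_cases H'; try lia; congr (_, _, _, _, _, _, _); lia.
have [Ew Ei] : k + j - i = e + 2 * b /\ i = - a - b.
  by upsilon_cases H; split; nia.
have [Ew' Ei'] : k' + j' - i = e' + 2 * b' /\ i = - a' - b'.
  by upsilon_cases H'; split; nia.
have [bb ee] : b' = b /\ e' = e by lia.
have aa : a' = a by lia.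
subst b' e' a'; have [jj kk] : j' = j /\ k' = k; last by rewrite jj kk.
by upsilon_cases H; upsilon_cases H'; lia.
Qed.

(** Weight 0 means [e = b = 0], so [a = - i] and [j] is an explicit function of [s], [t] and [i]. *)
Lemma weight0_step v : P_upsilon_le1 p v -> up_i v <= 0 -> weight v = 0 ->
  [\/ up_j v = up_i v /\
      (forall w, P_upsilon_le1 p w -> up_s w = up_s v -> up_t w = up_t v ->
         up_i w = up_i v -> weight w = 0),
      up_i v = 0 /\ up_j v <= - 1,
      up_i v = - 1 /\ up_j v <= - 2
    | up_i v <= -2 /\ up_j v + 1 <= p%:Z * (up_i v + 1)].
Proof.
case: v => -[[[[[s i] j] k] a] b] t /upsilonP [[hs ht ha hb] [e he H]].
rewrite /weight /= => i0 w0.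
have [Ew Ei] : k + j - i = e + 2 * b /\ i = - a - b.
  by upsilon_cases H; split; nia.
have [e0 b0] : e = 0 /\ b = 0 by lia.
subst e b.
have [i1|[i1|i1]] : i <= - 2 \/ i = -1 \/ i = 0 by lia.
- constructor 4; split=> //; upsilon_cases H; lia.
- have hj : j = - (t - s + p%:Z) by upsilon_cases H; nia.
  have [j1|j1] : j <= - 2 \/ j = -1 by lia.
    by constructor 3.
  constructor 1; split; first by rewrite j1.
  (* These are the digits of the tuples removed from [P_0] and [P_M], which leaves no step of
     positive weight. *)
  have [sp t1] : s = p%:Z /\ t = 1 by lia.
  case=> -[[[[[s' i'] j'] k'] a'] b'] t' /upsilonP [[_ _ ha' hb'] [e' he' H']].
  move=> /= ss tt ii; subst s' t' i' s t.
  by upsilon_cases H'; lia.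
- have [ts hj] : 0 <= t - s /\ j = - (t - s) by upsilon_cases H; split; lia.
  have [j1|j1] : j <= - 1 \/ j = 0 by lia.
    by constructor 2.
  constructor 1; split; first by rewrite j1.
  have st : s = t by lia.
  case=> -[[[[[s' i'] j'] k'] a'] b'] t' /upsilonP [[_ _ ha' hb'] [e' he' H']].
  move=> /= ss tt ii; subst s' t' i' s.
  by upsilon_cases H'; lia.
Qed.

End Step.

(** * Counting paths with prescribed digits *)

Lemma size_fibers (T : eqType) (g : T -> nat) (N : nat) (l : seq T) :
  {in l, forall x, (g x < N)%N} ->
  size l = (\sum_(w < N) count (fun x => g x == w) l)%N.
Proof.
elim: l => [|x l IH] gN; first by rewrite big1.
rewrite /= big_split /= -IH => [|y yl]; last by apply: gN; rewrite in_cons yl orbT.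
have gx : (g x < N)%N by apply: gN; rewrite mem_head.
rewrite (bigD1 (Ordinal gx)) //= eqxx big1 ?addn0 // => w wx.
by apply/eqP; rewrite eqb0; apply: contra wx => /eqP gw; apply/eqP/val_inj.
Qed.

Section Count.
Variables (p : nat) (p_gt1 : (1 < p)%N).

(* The tail of a path, from state [-i] and with degree [k] left to spend. *)
Fixpoint chain (i k : int) (vs : seq int7) : Prop :=
  if vs is v :: vs' then
    [/\ P_upsilon_le1 p v, up_i v = i & chain (up_j v) (k - up_k v) vs']
  else k = 0.

Lemma chain_ge0 vs i k : chain i k vs -> 0 <= k.
Proof.
elim: vs i k => [|v vs IH] i k /=; first by move=> ->.
by case=> /(up_k_ge0 p_gt1) v0 _ /IH; lia.
Qed.

(** A potential that grows by at least 1 at each raising step: [minn n 2] for the states below 2,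
    then the logarithm, since [n - 1] is multiplied by at least [p]. *)
Definition height (n : nat) : nat := (minn n 2 + trunc_log p n.-1)%N.

Lemma height_max n K : (n <= K)%N -> (height n <= 2 + trunc_log p K)%N.
Proof.
move=> nK; apply: leq_add; first by lia.
by apply: leq_trunc_log; lia.
Qed.

Lemma ltn_height n n' : (n < 2 -> n < n')%N -> (1 < n -> p * n.-1 <= n'.-1)%N ->
  (height n < height n')%N.
Proof.
rewrite /height; case: (ltnP n 2) => n2 H1 H2.
  have -> : n.-1 = 0%N by lia.
  by rewrite trunc_log0; lia.
have {}H2 := H2 isT; have n1 : (0 < n.-1)%N by lia.
have := leq_trunc_log p H2; rewrite trunc_logMp //.
have : (2 <= n')%N by nia.
by lia.
Qed.

Variable K : nat.
Let H := (2 + trunc_log p K)%N.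

(** Bounds the paths whose first step has positive weight: [u] is the weight left after that step,
    and [H.+2] is [trunc_log p K + 4]. *)
Definition geo (W : nat) : nat := (\sum_(u < W) H.+2 ^ u)%N.

Lemma geoE W : (1 + H.+1 * geo W = H.+2 ^ W)%N.
Proof.
elim: W => [|W IH]; first by rewrite /geo big_ord0 muln0.
by rewrite /geo big_ord_recr /= -/(geo W) mulnDr addnA IH expnS; lia.
Qed.

(* [k - i + 1] is the weight still available, and at most [H - height `|i|]
   steps can raise the state before the next step of positive weight; the state
   [-1], that is [i = 1], is absorbing and leaves no choice. *)
Definition chain_bound (i k : int) : nat :=
  if i == 1 then 1%N else (1 + (H - height `|i|%N).+1 * geo `|(k - i + 1)%R|%N)%N.

Lemma chain_bound_max i k : (chain_bound i k <= H.+2 ^ `|(k - i + 1)%R|%N)%N.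
Proof.
rewrite /chain_bound; case: ifP => _; first by rewrite expn_gt0.
by rewrite -geoE leq_add2l leq_mul2r ltnS leq_subr orbT.
Qed.

Definition head_weight (vs : seq int7) : nat :=
  if vs is v :: _ then `|weight v|%N else 0%N.

(** Induction on the digits, splitting [l] by the weight of the first step: by [weight_inj] each
    class has a single first step, so the induction hypothesis applies to the tails. *)
Lemma size_chains (l : seq (seq int7)) (ss ts : seq int) (i k : int) :
  uniq l -> i <= 1 -> k - i <= K%:Z ->
  (forall vs, vs \in l ->
     [/\ chain i k vs, map up_s vs = ss & map up_t vs = ts]) ->
  (size l <= chain_bound i k)%N.
Proof.
elim: ss ts l i k => [|s ss IH] ts l i k ul i1 kK hl.
  apply: (@leq_trans 1%N).
    apply: (@uniq_leq_size _ l [:: [::]]) => // vs /hl [_ + _].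
    by case: vs => //= _; rewrite inE.
  by rewrite /chain_bound; case: ifP.
case El: l => [|vs0 l0] //; rewrite -El.
have hvs0 : vs0 \in l by rewrite El mem_head.
case: ts hl => [|t ts] hl.
  by have [_] := hl _ hvs0; case: vs0 {El hvs0}.
have hcons vs : vs \in l -> exists v vs', [/\ vs = v :: vs', P_upsilon_le1 p v,
    [/\ up_i v = i, up_s v = s & up_t v = t], chain (up_j v) (k - up_k v) vs'
    & map up_s vs' = ss /\ map up_t vs' = ts].
  case: vs => [|v vs'] /hl [] //= [Pv vi cv] [vs_ ss'] [vt ts'].
  by exists v, vs'.
have class w : let lw := [seq vs <- l | head_weight vs == w] in
    lw = [::] \/ exists v, [/\ P_upsilon_le1 p v,
      [/\ up_i v = i, up_s v = s & up_t v = t],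
      weight v = w%:Z, 0 <= k - up_k v
      & (size lw <= chain_bound (up_j v) (k - up_k v))%N].
  move=> lw; case Elw: lw => [|vs1 lw1]; [by left|right].
  have /hcons : vs1 \in l.
    have : vs1 \in lw by rewrite Elw mem_head.
    by rewrite mem_filter => /andP[].
  case=> v [vs' [e1 Pv [vi v_s vt] cv _]].
  have wv : weight v = w%:Z.
    have : vs1 \in lw by rewrite Elw mem_head.
    rewrite mem_filter e1 /= => /andP[/eqP <- _].
    by have := weight_ge0 p_gt1 Pv; lia.
  exists v; split=> //; first exact: chain_ge0 cv.
  have hlw vs : vs \in lw -> exists vs', [/\ vs = v :: vs',
      chain (up_j v) (k - up_k v) vs' & map up_s vs' = ss /\ map up_t vs' = ts].
    rewrite mem_filter => /andP[/eqP hw /hcons [v2 [vs2 [e2 Pv2 []]]]] i2 s2 t2.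
    move=> c2 m2.
    have e : v2 = v.
      apply: (weight_inj p_gt1 Pv2 Pv); rewrite ?vi ?v_s ?vt //.
      rewrite wv -hw e2 /=.
      by have := weight_ge0 p_gt1 Pv2; lia.
    by exists vs2; rewrite -e.
  rewrite -Elw -(size_map behead); apply: (IH ts).
  - rewrite map_inj_in_uniq; first by rewrite filter_uniq.
    by move=> x y /hlw [x' [-> _ _]] /hlw [y' [-> _ _]] /= ->.
  - exact: up_j_le1 p_gt1 _ Pv.
  - by move: wv; rewrite /weight vi; lia.
  - by move=> vs /mapP [x /hlw [x' [-> cx [sx tx]]] ->].
have i_le0 : i = 1 \/ i <= 0 by lia.
case: i_le0 => i_le0.
  have all0 vs : vs \in l -> head_weight vs == 0%N.
    by case/hcons => v [vs' [-> Pv [vi _ _] _ _]] /=; rewrite (weight_i1 p_gt1) ?vi.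
  have [|[v [Pv [vi _ _] wv kv]]] := class 0%N.
    by move/all_filterP: (introT allP all0) => -> l0_; rewrite El in l0_.
  move/all_filterP: (introT allP all0) => ->.
  by rewrite /chain_bound (up_j_eq1 p_gt1 Pv) ?vi // i_le0.
pose W := `|(k - i + 1)%R|%N.
have k0 : 0 <= k by have [/chain_ge0] := hl _ hvs0.
have hW vs : vs \in l -> (head_weight vs < W.+1)%N.
  case/hcons => v [vs' [-> Pv [vi _ _] /chain_ge0 cv _]] /=.
  have := up_j_le1 p_gt1 Pv; have := weight_ge0 p_gt1 Pv.
  by rewrite /weight vi /W; lia.
have i_neq1 : (i == 1) = false by lia.
have tail : (\sum_(w < W) count (fun vs => head_weight vs == w.+1) l <= geo W)%N.
  (* Reversed, the index [w] is the weight left after a first step of weight [W - w]. *)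
  rewrite /geo (reindex_inj rev_ord_inj) /=; apply: leq_sum => w _.
  have wW := ltn_ord w.
  rewrite -size_filter; have [->|[v [_ [vi _ _] wv kv sz]]] := class (W - w.+1).+1%N.
    by [].
  apply: leq_trans sz (leq_trans (chain_bound_max _ _) _).
  rewrite leq_pexp2l //; move: wv wW; rewrite /weight vi /W; lia.
have E : chain_bound i k = (1 + (H - height `|i|%N) * geo W + geo W)%N.
  by rewrite /chain_bound i_neq1 mulSn addnCA addnC.
have sz_l : size l = (count (fun vs => head_weight vs == 0%N) l +
    \sum_(w < W) count (fun vs => head_weight vs == w.+1) l)%N.
  by rewrite (size_fibers hW) big_ord_recl.
have := class 0%N; rewrite /= size_filter; case=> [l00|[v [Pv [vi v_s vt] wv kv sz]]].
  by move: sz_l; rewrite -size_filter l00 add0n => ->; rewrite E (leq_trans tail) // leq_addl.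
have jk : k - up_k v - up_j v = k - i by move: wv; rewrite /weight vi; lia.
(* A step of weight 0 keeps [W], and the gain in height saves one copy of [geo W], which pays for
   the classes of positive weight. *)
have raise : up_j v <= - 1 -> (height `|i|%N < height `|up_j v|%N)%N ->
    (size l <= chain_bound i k)%N.
  move=> j_lt0 hij.
  have hH : (height `|up_j v|%N <= H)%N by apply: height_max; lia.
  rewrite sz_l E leq_add // (leq_trans sz) // /chain_bound.
  have -> : (up_j v == 1) = false by lia.
  by rewrite jk leq_add2l leq_mul2r; apply/orP; right; lia.
have := weight0_step p_gt1 Pv; rewrite vi => /(_ i_le0 wv).
case=> [[ji forced]|[hi hj]|[hi hj]|[hi hj]].
(* The class of weight 0 is all of [l], and neither the state nor [k] changes. *)
- have all0 : all (fun vs => head_weight vs == 0%N) l.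
    apply/allP => vs /hcons [v2 [vs' [-> Pv2 [vi2 vs2 vt2] _ _]]] /=.
    by rewrite (forced v2) // ?vs2 ?vt2.
  move: sz; rewrite -size_filter (all_filterP all0) ji.
  by have -> : k - up_k v = k by lia.
- by apply: raise; [lia | apply: ltn_height; lia].
- by apply: raise; [lia | apply: ltn_height; lia].
- by apply: raise; [nia | apply: ltn_height; nia].
Qed.

End Count.

(** * From basis elements to chains *)

Lemma digits_of_inj (p q m : nat) (s s' : 'I_q -> int) :
  digits_of p m s -> digits_of p m s' -> s =1 s'.
Proof.
rewrite /digits_of => -[hs ->] [hs']; elim: q s s' hs hs' => [|q IH] s s' hs hs' e.
  by case.
have split_last (r : 'I_q.+1 -> int) :
    \sum_(g < q.+1) (r g - 1) * p%:Z ^+ (q.+1 - g.+1)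
    = p%:Z * (\sum_(g < q) (r (widen_ord (leqnSn q) g) - 1) * p%:Z ^+ (q - g.+1))
      + (r ord_max - 1).
  rewrite big_ord_recr /= subnn expr0 mulr1 mulr_sumr; congr (_ + _).
  apply: eq_bigr => g _; rewrite subSn; last exact: ltn_ord.
  by rewrite exprS mulrCA.
move: e; rewrite !split_last.
have := hs ord_max; have := hs' ord_max.
set S := \sum_(g < q) _; set S' := \sum_(g < q) _ => h1 h2 e.
(* The lowest digits agree modulo [p] and differ by less than [p]. *)
have eS : S = S' by nia.
have el : s ord_max = s' ord_max by move: e; rewrite eS; lia.
have := IH _ _ (fun g => hs _) (fun g => hs' _) eS => hw g.
have [gq|gq] := ltnP g q.
  by have := hw (Ordinal gq); congr (s _ = s' _); apply: val_inj.
have -> // : g = ord_max by apply: val_inj => /=; have := ltn_ord g; lia.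
Qed.

Lemma chain_codom (p q : nat) (v : 'I_q -> int7) (i k : int) :
  (forall g, P_upsilon_le1 p (v g)) ->
  (forall g : 'I_q, g = 0%N :> nat -> up_i (v g) = i) ->
  (forall g h : 'I_q, h = g.+1 :> nat -> up_i (v h) = up_j (v g)) ->
  \sum_(g < q) up_k (v g) = k ->
  chain p i k [seq v g | g <- enum 'I_q].
Proof.
elim: q v i k => [|q IH] v i k Pv v0 vS.
  by rewrite big_ord0 => <-; rewrite (size0nil (size_enum_ord 0)).
rewrite big_ord_recl => <-; rewrite enum_ordSl /= -map_comp.
split; [exact: Pv | exact: v0 |].
apply: IH.
- by move=> g; apply: Pv.
- by move=> g g0; apply: vS; rewrite /= /bump g0.
- by move=> g h gh; apply: vS; rewrite /= /bump gh.
- by rewrite addrAC subrr add0r.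
Qed.

Lemma card_ext_basis (p q m l k d : nat) : (1 < p)%N ->
  ext_basis p q k%:Z m l #= `I_d -> (d <= (trunc_log p k + 4) ^ k.+1)%N.
Proof.
move=> p_gt1 /card_set_bijP [f [_ _ f_surj]].
(* A section of [f] lists [d] distinct paths. *)
have /choice [g hg] : forall n : 'I_d, exists v, ext_basis p q k%:Z m l v /\ f v = n.
  by move=> n; have [v Bv fv] := f_surj n (ltn_ord n); exists v.
pose path (v : {ffun 'I_q -> int7}) := [seq v h | h <- enum 'I_q].
have path_inj : injective path.
  move=> v w /eq_in_map vw; apply/ffunP => h.
  by apply: vw; rewrite mem_enum.
have g_inj : injective g.
  by move=> n n' nn'; apply: val_inj; rewrite /= -(hg n).2 -(hg n').2 nn'.
have [d0|n0] := posnP d; first by rewrite d0.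
pose v0 := g (Ordinal n0).
have [_ [ds0 dt0] _ _ _] := (hg (Ordinal n0)).1.
have := @size_chains p p_gt1 k [seq path (g n) | n <- enum 'I_d]
  (map up_s (path v0)) (map up_t (path v0)) 0 k%:Z.
rewrite size_map size_enum_ord => H; apply: leq_trans (H _ _ _ _) _ => //.
- rewrite map_inj_uniq ?enum_uniq //.
  by move=> n n' /path_inj /g_inj.
- by rewrite subr0.
- move=> vs /mapP [n _ ->]; have [[Pv [ds dt] vi vS vk] _] := hg n.
  split; first exact: chain_codom.
    rewrite -!map_comp; apply/eq_map => h /=.
    exact: digits_of_inj ds ds0 h.
  rewrite -!map_comp; apply/eq_map => h /=.
  exact: digits_of_inj dt dt0 h.
- apply: leq_trans (chain_bound_max p_gt1 _ _ _) _.
  have -> : `|(k%:Z - 0 + 1)%R|%N = k.+1 by lia.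
  by rewrite leq_exp2r; lia.
Qed.

(** * Real logarithms and the maximum *)

Lemma trunc_log_le_ln (R : realType) (p n : nat) : (1 < p)%N ->
  (trunc_log p n)%:R <= ln (n%:R + 1) / ln p%:R :> R.
Proof.
move=> p_gt1; have lnp : 0 < ln p%:R :> R by rewrite ln_gt0 // ltr1n.
rewrite ler_pdivlMr //; have p0 : 0 < p%:R :> R by rewrite ltr0n; lia.
rewrite mulr_natl -lnXn // ler_ln ?posrE ?exprn_gt0 //.
rewrite -natrX natr1 ler_nat.
(* At [n = 0] the default [trunc_log p 0 = 0] gives [1 <= 0 + 1]. *)
case: n => [|n]; first by rewrite trunc_log0 expn0.
exact: leq_trans (trunc_logP p_gt1 _) _.
Qed.

(** One of the [k + 1] factors is at most [k + 4] and goes into the cube; each of the others is at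
    most [32 * (ln (k + 1) / ln p) + 96]. *)
Lemma ext_bound (R : realType) (p k : nat) : (1 < p)%N ->
  ((trunc_log p k + 4) ^ k.+1)%N%:R
    <= (k%:R + 4) ^+ 3 * (32 * (ln (k%:R + 1) / ln p%:R) + 96) ^+ k :> R.
Proof.
move=> p_gt1; rewrite expnS natrM natrX; apply: ler_pM => //.
- have tk : (trunc_log p k <= k)%N.
    case: k => [|k]; first by rewrite trunc_log0.
    have := trunc_logP p_gt1 (ltn0Sn k); apply: leq_trans.
    exact: ltnW (ltn_expl _ p_gt1).
  have h4 : 1 <= k%:R + 4 :> R by rewrite -natrD ler1n; lia.
  apply: (@le_trans _ _ (k%:R + 4)); first by rewrite -natrD ler_nat leq_add2r.
  by apply: ler_eXnr.
- apply: lerXn2r; rewrite ?nnegrE //.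
    have := @trunc_log_le_ln R p k p_gt1; have := ler0n R (trunc_log p k); lra.
  rewrite natrD.
  have := @trunc_log_le_ln R p k p_gt1; have := ler0n R (trunc_log p k); lra.
Qed.

Theorem theorem50 (R : realType) (p : nat) (hp : prime p)
    (F : closedFieldType) (hF : p \in [pchar F])
    (w : nat -> seq (nat * nat))
    (hw : forall q : nat, (2 <= q)%N -> is_block F (w q) /\ size (w q) = (p ^ q)%N)
    (hMT : Miemietz_Turner F p)
    (k : nat) :
  exists X : nat,
    [/\ weyl_ext_dims F p w k X,
        forall d : nat, weyl_ext_dims F p w k d -> (d <= X)%N
      & X%:R <= (k%:R + 4) ^+ 3 * (32 * (ln (k%:R + 1) / ln p%:R) + 96) ^+ k :> R].
Proof.
have p_gt1 := prime_gt1 hp.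
have dims_le d : weyl_ext_dims F p w k d -> (d <= (trunc_log p k + 4) ^ k.+1)%N.
  case=> q [m [l [q2 hm hl ->]]]; have [bw sw] := hw q q2.
  exact: card_ext_basis p_gt1 (hMT q (w q) q2 bw sw k m l hm hl).
(* A maximum needs a nonempty set: [q = 2], [m = l = 1] supply an element. *)
have ex_dim : exists d, `[< weyl_ext_dims F p w k d >].
  exists (ext_dim (block_weyl F (w 2) 1) (block_weyl F (w 2) 1) k).
  by apply/asboolP; exists 2%N, 1%N, 1%N; split; rewrite // expn_gt0; lia.
have [X /asboolP wX maxX] := ex_maxnP ex_dim (fun d hd => dims_le d (asboolW hd)).
exists X; split=> // [d /asboolP /maxX //|].
by apply: le_trans (ext_bound R k p_gt1); rewrite ler_nat dims_le.
Qed.
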